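(* Let $F$ be a finitely generated free monoid of rank $r$ and $G$ a finite group. Then the free product $F * G$ is quasi-isometric to a free monoid of rank $r|G|$.
   Context: The free product $F*G$ is the free product of monoids. Let $\mathbb{R}^\infty = \mathbb{R}^{\ge 0}\cup\{\infty\}$ with the obvious order, addition and multiplication ($0\cdot\infty$ undefined). A semimetric on a set $X$ is a function $d:X\times X\to\mathbb{R}^\infty$ with (i) $d(x,y)=0$ if and only if $x=y$, and (ii) $d(x,z)\le d(x,y)+d(y,z)$ for all $x,y,z$ (symmetry is not required). A semimetric space is a set equipped with a semimetric. The strong ball of radius $r$ around $x_0$ is $\{y: d(x_0,y)\le r \text{ and } d(y,x_0)\le r\}$. A map $f:X\to Y$ of semimetric spaces is a quasi-isometry if there are constants $1\le\lambda<\infty$, $0<\epsilon<\infty$, $1\le\mu<\infty$ such that $\frac1\lambda d(x,y)-\epsilon\le d(f(x),f(y))\le\lambda d(x,y)+\epsilon$ for all $x,y\in X$, and every point of $Y$ lies in the strong ball of radius $\mu$ around some point of $f(X)$. $X$ and $Y$ are quasi-isometric if there is a quasi-isometry $X\to Y$ (this is an equivalence relation). If $M$ is a monoid generated by a finite set $S$, it is a semimetric space under $d_S(x,y)$ = shortest length of a word $w$ over $S$ with $xw=y$ in $M$, or $\infty$ if there is none. Its quasi-isometry type does not depend on the choice of finite generating set $S$; two finitely generated monoids are quasi-isometric if they are so as semimetric spaces with respect to some (equivalently any) finite generating sets. *)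

(* Defs.v *)
From HB Require Import structures.
From mathcomp Require Import all_boot all_order all_algebra.
From mathcomp Require Import finmap boolp reals constructive_ereal.
Set Implicit Arguments.
Unset Strict Implicit.
Unset Printing Implicit Defensive.
Import Order.TTheory GRing.Theory Num.Theory.

Local Open Scope quotient_scope.
Local Open Scope group_scope.

Section Semimetric.
Variable R : realType.
Local Open Scope ereal_scope.

Record semimetricSpace := SemimetricSpace {
  carrier :> Type;
  dist : carrier -> carrier -> \bar R;
  dist_ge0 : forall x y, 0 <= dist x y;
  dist_eq0 : forall x y, dist x y = 0 <-> x = y;
  dist_triangle : forall x y z, dist x z <= dist x y + dist y z }.

Definition strong_ball (X : semimetricSpace) (x0 : X) (r : R) (y : X) : Prop :=
  dist x0 y <= r%:E /\ dist y x0 <= r%:E.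

(* When [dist x y = +oo], the left-hand side below is [+oo]. *)
Definition quasi_isometry (X Y : semimetricSpace) (f : X -> Y) : Prop :=
  exists lambda eps mu : R,
    [/\ (1 <= lambda)%R, (0 < eps)%R, (1 <= mu)%R,
        forall x y, lambda^-1%:E * dist x y - eps%:E <= dist (f x) (f y)
                    <= lambda%:E * dist x y + eps%:E
      & forall y, exists x, strong_ball (f x) mu y].

Definition quasi_isometric (X Y : semimetricSpace) : Prop :=
  exists f : X -> Y, quasi_isometry f.

End Semimetric.

Section WordSemimetric.
Variables (R : realType) (M : monoidType) (S : {fset M}).

Definition generates : Prop :=
  forall x : M, exists2 w : seq M, {subset w <= S} & x = \prod_(a <- w) a.

Definition word_between (x y : M) (n : nat) : bool :=
  `[< exists w : seq M,
        [/\ {subset w <= S}, size w = n & x * \prod_(a <- w) a = y] >].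

Definition word_dist (x y : M) : \bar R :=
  if pselect (exists n, word_between x y n) is left h
  then ((ex_minn h)%:R)%:E%E else +oo%E.

Lemma word_dist_ge0 x y : (0 <= word_dist x y)%E.
Proof.
rewrite /word_dist; case: pselect => [h|_]; last exact: leey.
by rewrite lee_fin ler0n.
Qed.

Lemma word_dist_le x y n :
  word_between x y n -> (word_dist x y <= (n%:R)%:E)%E.
Proof.
move=> xy; rewrite /word_dist; case: pselect => [h|[]]; last by exists n.
by case: ex_minnP => m _ /(_ n xy) mn; rewrite lee_fin ler_nat.
Qed.

Lemma word_dist_spec x y :
  word_dist x y = +oo%E \/
  exists2 n, word_between x y n & word_dist x y = (n%:R)%:E%E.
Proof.
rewrite /word_dist; case: pselect => [h|_]; [right|by left].
by case: ex_minnP => m xy _; exists m.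
Qed.

Lemma word_dist_eq0 x y : word_dist x y = 0%E <-> x = y.
Proof.
split=> [d0|->].
  have [|[n /asboolP[w [_ wn xy]]]] := word_dist_spec x y; first by rewrite d0.
  rewrite d0 => -[/esym/eqP]; rewrite pnatr_eq0 => /eqP n0.
  by rewrite -xy (size0nil (etrans wn n0)) big_nil mulg1.
apply/eqP; rewrite eq_le word_dist_ge0 andbT; apply: (@word_dist_le y y 0).
by apply/asboolP; exists [::]; rewrite big_nil mulg1.
Qed.

Lemma word_dist_triangle x y z :
  (word_dist x z <= word_dist x y + word_dist y z)%E.
Proof.
have yzNy : word_dist y z != -oo%E.
  by have [->|[n _ ->]] := word_dist_spec y z.
have [->|[m /asboolP[v [vS <- xy]] ->]] := word_dist_spec x y.
  by rewrite addye // leey.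
have [->|[n /asboolP[w [wS <- yz]] ->]] := word_dist_spec y z.
  by rewrite addey // leey.
rewrite -EFinD -natrD; apply: word_dist_le; apply/asboolP; exists (v ++ w).
split; last by rewrite big_cat mulgA xy.
- by move=> a; rewrite mem_cat => /orP[/vS|/wS].
- exact: size_cat.
Qed.

Definition word_space : semimetricSpace R :=
  SemimetricSpace word_dist_ge0 word_dist_eq0 word_dist_triangle.

End WordSemimetric.

Definition monoid_quasi_isometric (R : realType) (M N : monoidType) : Prop :=
  exists (S : {fset M}) (T : {fset N}),
    [/\ generates S, generates T
      & quasi_isometric (word_space R S) (word_space R T)].

Definition free_of_rank (M : monoidType) (r : nat) : Prop :=
  exists e : 'I_r -> M, bijective (fun w : seq 'I_r => \prod_(i <- w) e i).

Definition words (A : Type) := seq A.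

HB.instance Definition _ (A : choiceType) := Choice.on (words A).
HB.instance Definition _ (A : choiceType) :=
  isMonoid.Build (words A) (@catA A) (@cat0s A) (@cats0 A).

Lemma words_free r : free_of_rank (words 'I_r) r.
Proof.
exists (fun i => [:: i] : words 'I_r); exists id => w;
  by elim: w => [|i w IH]; rewrite ?big_nil // big_cons IH.
Qed.

Section FreeProduct.
Variables M N : monoidType.

(* The least congruence on words over the disjoint union of M and N that
   identifies the products and units of M and N with those of words. *)
Inductive fp_cong : seq (M + N) -> seq (M + N) -> Prop :=
| fp_refl u : fp_cong u u
| fp_sym u v : fp_cong u v -> fp_cong v u
| fp_trans u v w : fp_cong u v -> fp_cong v w -> fp_cong u w
| fp_cat u u' v v' : fp_cong u u' -> fp_cong v v' -> fp_cong (u ++ v) (u' ++ v')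
| fp_mull x y : fp_cong [:: inl x; inl y] [:: inl (x * y)]
| fp_onel : fp_cong [:: inl 1] [::]
| fp_mulr x y : fp_cong [:: inr x; inr y] [:: inr (x * y)]
| fp_oner : fp_cong [:: inr 1] [::].

Definition fp_rel (u v : seq (M + N)) : bool := `[< fp_cong u v >].

Lemma fp_rel_equiv : equiv_class_of fp_rel.
Proof.
split=> [u|u v|v u w].
- exact/asboolP/fp_refl.
- by apply/asboolP/asboolP; apply: fp_sym.
- move=> /asboolP uv /asboolP vw; exact/asboolP/(fp_trans uv vw).
Qed.
Canonical fp_equiv := EquivRelPack fp_rel_equiv.

Definition free_product := {eq_quot fp_equiv}.
HB.instance Definition _ := Choice.on free_product.
HB.instance Definition _ := EqQuotient.on free_product.

Definition fp_class (u : seq (M + N)) : free_product := \pi_free_product u.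

Lemma fp_classP u v : fp_class u = fp_class v <-> fp_cong u v.
Proof. by split=> [/eqquotP/asboolP|uv] //; apply/eqquotP/asboolP. Qed.

Lemma fp_repr (p : free_product) : fp_class (repr p) = p.
Proof. exact: reprK. Qed.

Definition fp_mul (p q : free_product) := fp_class (repr p ++ repr q).

Lemma fp_mulE u v : fp_mul (fp_class u) (fp_class v) = fp_class (u ++ v).
Proof. by apply/fp_classP/fp_cat; apply/fp_classP; rewrite fp_repr. Qed.

Lemma fp_mulA : associative fp_mul.
Proof.
move=> p q s; rewrite -[p]fp_repr -[q]fp_repr -[s]fp_repr.
by rewrite !fp_mulE catA.
Qed.

Lemma fp_mul1 : left_id (fp_class [::]) fp_mul.
Proof. by move=> p; rewrite -[p]fp_repr fp_mulE. Qed.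

Lemma fp_1mul : right_id (fp_class [::]) fp_mul.
Proof. by move=> p; rewrite -[p]fp_repr fp_mulE cats0. Qed.

HB.instance Definition _ :=
  isMonoid.Build free_product fp_mulA fp_mul1 fp_1mul.

Lemma fp_classM u v : fp_class u * fp_class v = fp_class (u ++ v).
Proof. exact: fp_mulE. Qed.

Definition fp_inl (x : M) : free_product := fp_class [:: inl x].
Definition fp_inr (y : N) : free_product := fp_class [:: inr y].

Lemma fp_inl1 : fp_inl 1 = 1. Proof. exact/fp_classP/fp_onel. Qed.
Lemma fp_inlM : {morph fp_inl : x y / x * y}.
Proof. by move=> x y; rewrite fp_classM; apply/fp_classP/fp_sym/fp_mull. Qed.
Lemma fp_inr1 : fp_inr 1 = 1. Proof. exact/fp_classP/fp_oner. Qed.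
Lemma fp_inrM : {morph fp_inr : x y / x * y}.
Proof. by move=> x y; rewrite fp_classM; apply/fp_classP/fp_sym/fp_mulr. Qed.

HB.instance Definition _ := isUMagmaMorphism.Build _ _ fp_inl (fp_inl1, fp_inlM).
HB.instance Definition _ := isUMagmaMorphism.Build _ _ fp_inr (fp_inr1, fp_inrM).

Lemma free_product_universal (Q : monoidType)
    (f : UMagmaMorphism.type M Q) (g : UMagmaMorphism.type N Q) :
  exists h : UMagmaMorphism.type free_product Q,
    [/\ h \o fp_inl =1 f, h \o fp_inr =1 g
      & forall h' : UMagmaMorphism.type free_product Q,
          h' \o fp_inl =1 f -> h' \o fp_inr =1 g -> h' =1 h].
Proof.
pose fg (a : M + N) := match a with inl x => f x | inr y => g y end.
pose h0 (u : seq (M + N)) := \prod_(a <- u) fg a.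
have h0_cong u v : fp_cong u v -> h0 u = h0 v.
  rewrite /h0; elim=> {u v}.
  - by [].
  - by move=> u v _ ->.
  - by move=> u v w _ -> _ ->.
  - by move=> u u' v v' _ uu' _ vv'; rewrite !big_cat /= uu' vv'.
  - by move=> x y; rewrite !big_cons big_nil !mulg1 /= gmulfM.
  - by rewrite big_seq1 big_nil /= gmulf1.
  - by move=> x y; rewrite !big_cons big_nil !mulg1 /= gmulfM.
  - by rewrite big_seq1 big_nil /= gmulf1.
pose h (p : free_product) := h0 (repr p).
have hE u : h (fp_class u) = h0 u.
  by apply: h0_cong; apply/fp_classP; rewrite fp_repr.
have h1 : h 1 = 1 by rewrite hE /h0 big_nil.
have hM : {morph h : p q / p * q}.
  move=> p q; rewrite -[p in LHS]fp_repr -[q in LHS]fp_repr fp_classM hE.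
  by rewrite /h0 big_cat.
pose hm := isUMagmaMorphism.Build _ _ h (h1, hM).
pose hh : UMagmaMorphism.type free_product Q := HB.pack h hm.
exists hh; split.
- by move=> x; rewrite /= hE /h0 big_seq1.
- by move=> y; rewrite /= hE /h0 big_seq1.
move=> h' h'l h'r p; rewrite -[p]fp_repr /= hE.
elim: (repr p) => [|a u IH]; first by rewrite gmulf1 /h0 big_nil.
rewrite /h0 big_cons -/(h0 u) -IH.
rewrite -cat1s -fp_classM gmulfM; congr (_ * _).
by case: a => [x|y]; [exact: h'l|exact: h'r].
Qed.

End FreeProduct.

(* Main.v *)
Require Import Defs.
From mathcomp Require Import all_boot all_order all_algebra all_fingroup.
From mathcomp Require Import reals.
From mathcomp Require Import finmap boolp constructive_ereal generic_quotient.
From mathcomp Require Import lra.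

(** An element of [F * G] is uniquely of the form
    [g_0 x_1 g_1 x_2 ... x_n g_n] with [x_k] free generators and [g_k] in [G].
    Send it to the word [(g_0, x_1) (g_1, x_2) ... (g_(n-1), x_n)] over the
    [r * #|G|] letters [G * 'I_r], forgetting the last factor [g_n].  As [g_n]
    is invertible, [p] left divides [q] iff the word of [p] is a prefix of the
    word of [q], and then the two distances agree up to a factor [2] and an
    additive constant. *)

Set Implicit Arguments.
Unset Strict Implicit.
Unset Printing Implicit Defensive.
Import Order.TTheory GRing.Theory Num.Theory.

Local Open Scope group_scope.

(** Translates a shortest word over [S] into one over [T], with [k] bounding the new length. If
    there is no word over [S], positivity of [a] makes the right-hand side infinite. *)
Lemma word_dist_comparison (R : realType) (M N : monoidType) (S : {fset M})
    (T : {fset N}) (x y : M) (x' y' : N) (k : nat -> nat) (a b : R) :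
  (0 < a)%R -> (forall n, (k n)%:R <= a * n%:R + b)%R ->
  (forall n, word_between S x y n ->
     exists2 m, m <= k n & word_between T x' y' m) ->
  (word_dist R T x' y' <= a%:E * word_dist R S x y + b%:E)%E.
Proof.
move=> a0 kab xy; have [->|[n /xy[m mk xy'] ->]] := word_dist_spec R S x y.
  by rewrite gt0_muley ?lte_fin // addye // leey.
apply: le_trans (word_dist_le R xy') _.
by rewrite -EFinM -EFinD lee_fin (le_trans _ (kab n)) // ler_nat.
Qed.

Lemma quasi_isometry_of_bounds (R : realType) (X Y : semimetricSpace R)
    (f : X -> Y) (a b : R) :
  (1 <= a)%R -> (0 < b)%R ->
  (forall x y, dist (f x) (f y) <= a%:E * dist x y + b%:E)%E ->
  (forall x y, dist x y <= a%:E * dist (f x) (f y) + b%:E)%E ->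
  (forall y, exists x, f x = y) ->
  quasi_isometry f.
Proof.
move=> a1 b0 ub lb fsurj; exists a, b, 1%R; split=> //; last first.
  move=> y; have [x <-] := fsurj y; exists x.
  by rewrite /strong_ball (dist_eq0 _ _).2 // lee_fin ler01.
move=> x y; rewrite ub andbT.
have a0 : (0 < a)%R by apply: lt_le_trans a1.
have := lb x y; have := dist_ge0 x y; have := dist_ge0 (f x) (f y).
case: (dist (f x) (f y)) => [t| |] //; last by move=> *; rewrite leey.
case: (dist x y) => [s| |] //.
rewrite -!EFinM -EFinD -EFinB !lee_fin => t0 s0 st.
(* After multiplication by [a] the goal is [s <= a * t + a * b], weaker than [st] because
   [a >= 1]. *)
rewrite lerBlDr mulrC ler_pdivrMr // mulrDl (le_trans st) //.
by rewrite mulrC lerD2l ler_peMr // ltW.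
Qed.

(** * Word distance in a free monoid *)

Section FreeMonoid.
Variables (M : monoidType) (I : finType) (e : I -> M).
Hypothesis e_bij : bijective (fun w : seq I => \prod_(i <- w) e i).

Definition letters : {fset M} := [fset x in [seq e i | i <- enum I]]%fset.

Lemma mem_letters i : e i \in letters.
Proof. by rewrite inE /= map_f // mem_enum. Qed.

Lemma lettersP (w : seq M) :
  {subset w <= letters} -> exists u : seq I, w = map e u.
Proof.
elim: w => [|x w IH] wS; first by exists [::].
have [|u ->] := IH; first by move=> y yw; apply: wS; rewrite inE yw orbT.
have /mapP[i _ ->] : x \in [seq e i | i <- enum I].
  by have := wS x (mem_head _ _); rewrite inE.
by exists (i :: u).
Qed.

Lemma letters_generate : generates letters.
Proof.
have [d _ eK] := e_bij; move=> x; exists (map e (d x)).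
  by move=> _ /mapP[i _ ->]; apply: mem_letters.
by rewrite big_map eK.
Qed.

(** Unique factorization turns right multiplication into appending, so a finite distance measures
    how far a prefix is extended. *)
Lemma letters_word_betweenP (u v : seq I) n :
  reflect (exists2 w, v = u ++ w & size w = n)
    (word_between letters (\prod_(i <- u) e i) (\prod_(i <- v) e i) n).
Proof.
apply: (iffP (asboolP _)) => [[w [/lettersP[w' ->]]]|[w -> <-]].
  rewrite size_map big_map -big_cat => <- /(bij_inj e_bij) <-.
  by exists w'.
exists (map e w); rewrite size_map big_map big_cat; split=> //.
by move=> _ /mapP[i _ ->]; apply: mem_letters.
Qed.

End FreeMonoid.

(** Reindexing along [enum_rank] allows [G * 'I_r] as the alphabet. *)
Lemma free_of_rank_fin (M : monoidType) (I : finType) n :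
  #|I| = n -> free_of_rank M n ->
  exists e : I -> M, bijective (fun w : seq I => \prod_(i <- w) e i).
Proof.
move=> <- [e e_bij]; exists (e \o enum_rank).
have rank_bij : bijective (map (@enum_rank I)).
  by exists (map enum_val); apply: mapK; [exact: enum_rankK|exact: enum_valK].
apply: (eq_bij (bij_comp e_bij rank_bij)) => w.
by rewrite /= big_map.
Qed.

(** * Normal forms in the free product *)

Section NormalForm.
Variables (F : monoidType) (G : finGroupType) (r : nat) (e : 'I_r -> F).
Variable d : F -> seq 'I_r.
Hypothesis dK : cancel (fun w : seq 'I_r => \prod_(i <- w) e i) d.
Hypothesis eK : cancel d (fun w : seq 'I_r => \prod_(i <- w) e i).

Local Notation FG := (free_product F G).
(* The state [([:: (g_0, x_1); ...; (g_(n-1), x_n)], g_n)] stands for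
   [g_0 x_1 ... x_n g_n]; the free product acts on states from the right. *)
Local Notation state := (seq (G * 'I_r) * G)%type.

Definition push (s : state) (i : 'I_r) : state := (rcons s.1 (s.2, i), 1).

Definition act (s : state) (a : F + G) : state :=
  match a with
  | inl x => foldl push s (d x)
  | inr h => (s.1, s.2 * h)
  end.

(** Each defining relation acts trivially, [d] being a monoid morphism, so the action descends to
    the free product. *)
Lemma act_cong u v : fp_cong u v -> forall s, foldl act s u = foldl act s v.
Proof.
have d1 : d 1 = [::] by rewrite -[RHS]dK big_nil.
have dM x y : d (x * y) = d x ++ d y by rewrite -[RHS]dK big_cat !eK.
elim=> {u v} //=.
- by move=> u v w _ uv _ vw s; rewrite uv.
- by move=> u u' v v' _ uu' _ vv' s; rewrite !foldl_cat uu' vv'.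
- by move=> x y s; rewrite dM foldl_cat.
- by move=> s; rewrite d1.
- by move=> x y s; rewrite mulgA.
- by case=> w g; rewrite mulg1.
Qed.

Definition run (s : state) (p : FG) : state := foldl act s (repr p).

Lemma run_class s u : run s (fp_class u) = foldl act s u.
Proof. by apply: act_cong; apply/fp_classP; rewrite fp_repr. Qed.

Lemma runM s p q : run s (p * q) = run (run s p) q.
Proof.
by rewrite -[p]fp_repr -[q]fp_repr fp_classM !run_class foldl_cat.
Qed.

Lemma run1 s : run s 1 = s.
Proof. exact: (run_class s [::]). Qed.

Lemma run_inl s i : run s (fp_inl G (e i)) = push s i.
Proof.
have ei : e i = \prod_(j <- [:: i]) e j by rewrite big_seq1.
by rewrite run_class /= [e i]ei dK.
Qed.

Lemma run_inr s h : run s (fp_inr F h) = (s.1, s.2 * h).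
Proof. exact: run_class. Qed.

(** Two generators per letter: the source of the factor 2. *)
Definition spell (w : seq (G * 'I_r)) : seq FG :=
  flatten [seq [:: fp_inr F a.1; fp_inl G (e a.2)] | a <- w].

Lemma size_spell w : size (spell w) = (size w).*2.
Proof. by elim: w => //= a w ->. Qed.

Definition value (s : state) : FG := \prod_(x <- spell s.1) x * fp_inr F s.2.

Lemma value_push s i : value (push s i) = value s * fp_inl G (e i).
Proof.
rewrite /value /spell /= map_rcons flatten_rcons big_cat /= !big_cons big_nil.
by rewrite fp_inr1 !mulg1 !mulgA.
Qed.

Lemma value_act s a : value (act s a) = value s * fp_class [:: a].
Proof.
case: a => [x|h] /=; last first.
  by rewrite /value /= fp_inrM mulgA.
rewrite -/(fp_inl G x) -{2}[x]eK; elim: (d x) s => [|i w IH] s /=.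
  by rewrite big_nil fp_inl1 mulg1.
by rewrite IH value_push big_cons fp_inlM mulgA.
Qed.

(** [value] intertwines the action with right multiplication; starting from the empty state, this
    shows that every element is the value of its normal form. *)
Lemma value_run s p : value (run s p) = value s * p.
Proof.
rewrite -[p]fp_repr run_class; elim: (repr p) s => [|a u IH] s /=.
  by rewrite mulg1.
by rewrite IH value_act -(cat1s a u) -fp_classM mulgA.
Qed.

(** Distinct states have distinct values: this is uniqueness of the normal form. *)
Lemma run_value s : run ([::], 1) (value s) = s.
Proof.
case: s => w g; rewrite /value runM run_inr /=.
(* The prefix [w0] already read must vary for the induction. *)
suff -> w0 : run (w0, 1) (\prod_(x <- spell w) x) = (w0 ++ w, 1).
  by rewrite mul1g.
elim: w w0 => [|[a i] w IH] w0 /=; first by rewrite big_nil run1 cats0.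
by rewrite !big_cons !runM run_inr run_inl /push /= mul1g IH cat_rcons.
Qed.

Definition normal_form (p : FG) : state := run ([::], 1) p.

Lemma normal_formK : cancel normal_form value.
Proof. by move=> p; rewrite value_run /value big_nil fp_inr1 !mul1g. Qed.

(** Taking all of the finite group [G] makes every factor from [G] cost one letter. *)
Definition fp_gens : {fset FG} :=
  [fset x in [seq fp_inl G (e i) | i <- enum 'I_r]
               ++ [seq fp_inr F h | h <- enum G]]%fset.

Lemma fp_gensP x :
  reflect ((exists i, x = fp_inl G (e i)) \/ exists h, x = fp_inr F h)
    (x \in fp_gens).
Proof.
rewrite !inE /=; apply: (iffP orP).
  by case=> /mapP[y _ ->]; [left|right]; exists y.
by case=> -[y ->]; [left|right]; apply/mapP; exists y; rewrite ?mem_enum.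
Qed.

Lemma spell_gens w : {subset spell w <= fp_gens}.
Proof.
move=> x xw; apply/fp_gensP; move: xw => /flattenP[_ /mapP[[h i] _ ->]].
by rewrite !inE => /orP[]/eqP->; [right; exists h|left; exists i].
Qed.

Lemma fp_gens_generate : generates fp_gens.
Proof.
move=> p; exists (rcons (spell (normal_form p).1) (fp_inr F (normal_form p).2)).
  move=> x; rewrite mem_rcons inE => /orP[/eqP->|/spell_gens//].
  by apply/fp_gensP; right; eexists.
by rewrite -cats1 big_cat big_seq1 -[LHS]normal_formK.
Qed.

(** A free generator appends one letter to the first component, an element of [G] leaves it
    unchanged, and nothing shortens it. *)
Lemma run_gens s (v : seq FG) :
  {subset v <= fp_gens} ->
  exists2 w, (run s (\prod_(x <- v) x)).1 = s.1 ++ w & size w <= size v.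
Proof.
elim: v s => [|x v IH] s vS; first by exists [::]; rewrite // big_nil run1 cats0.
have vS' : {subset v <= fp_gens} by move=> y yv; apply: vS; rewrite inE yv orbT.
rewrite big_cons runM.
have /fp_gensP[[i ->]|[h ->]] := vS x (mem_head _ _).
  rewrite run_inl; have [w -> wv] := IH (push s i) vS'.
  by exists ((s.2, i) :: w); rewrite //= cat_rcons.
rewrite run_inr; have [w -> wv] := IH (s.1, s.2 * h) vS'.
by exists w; rewrite // ltnW.
Qed.

Lemma fp_word_between_prefix p q n : word_between fp_gens p q n ->
  exists2 w, (normal_form q).1 = (normal_form p).1 ++ w & size w <= n.
Proof.
by move=> /asboolP[v [vS <- <-]]; rewrite /normal_form runM; apply: run_gens.
Qed.

(* Cancel the last factor of [p], spell [w], then append the last factor of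
   [q]. *)
Lemma prefix_fp_word_between p q w :
  (normal_form q).1 = (normal_form p).1 ++ w ->
  word_between fp_gens p q (size w).*2.+2.
Proof.
move=> pq; apply/asboolP.
exists (fp_inr F (normal_form p).2^-1
        :: rcons (spell w) (fp_inr F (normal_form q).2)); split.
- move=> x; rewrite inE mem_rcons inE => /or3P[/eqP->|/eqP->|/spell_gens//];
    by apply/fp_gensP; right; eexists.
- by rewrite /= size_rcons size_spell.
- rewrite -{1}(normal_formK p) -[RHS]normal_formK /value pq.
  rewrite big_cons -cats1 big_cat big_seq1 /= !mulgA.
  rewrite -(mulgA _ (fp_inr F _) (fp_inr F _)) -fp_inrM mulgV fp_inr1 mulg1.
  by rewrite /spell map_cat flatten_cat big_cat.
Qed.

End NormalForm.

(** * The quasi-isometry *)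

Theorem corollary4p5 (R : realType) (r : nat) (F : monoidType)
    (G : finGroupType) (H : monoidType) :
  free_of_rank F r ->
  free_of_rank H (r * #|G|) ->
  monoid_quasi_isometric R (free_product F G) H.
Proof.
move=> [e [d dK eK]] Hfree.
have card : #|{: G * 'I_r}| = (r * #|G|)%N by rewrite card_prod card_ord mulnC.
have [c c_bij] := free_of_rank_fin card Hfree.
exists (fp_gens G e), (letters c); split.
- exact: fp_gens_generate dK eK.
- exact: letters_generate.
pose f p := \prod_(a <- (normal_form d p).1) c a.
exists (f : word_space R (fp_gens G e) -> word_space R (letters c)).
(* A word of [n] letters lifts to [2 * n + 2] generators, the last two adjusting the end factors in
   [G]; the other direction does not lengthen words. *)
apply: (@quasi_isometry_of_bounds _ _ _ _ 2%R 2%R).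
- lra.
- lra.
- move=> p q; apply: (word_dist_comparison (k := id)) => [|n|n pq]; first lra.
    by have := ler0n R n; lra.
  have [w pw wn] := fp_word_between_prefix dK eK pq.
  by exists (size w) => //; apply/letters_word_betweenP => //; exists w.
- move=> p q; apply: (word_dist_comparison (k := fun n => n.*2.+2)) => [|n|n].
  + lra.
  + by rewrite -addn2 -muln2 natrD natrM mulrC.
  + move=> /(letters_word_betweenP c_bij)[w pw <-].
    by exists (size w).*2.+2 => //; apply: prefix_fp_word_between pw.
- move=> y; have [dc _ cK] := c_bij.
  (* Any last factor would do; [1] is chosen. *)
  by exists (value e (dc y, 1)); rewrite /f /normal_form (run_value dK eK) /= cK.
Qed.
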